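(* (1) If $\mathfrak{b}=\aleph_1$, then there exists an uncountable meager additive set $X\subseteq 2^\omega$. (2) If $\mathfrak{d}=\aleph_1$, then there exists an uncountable null additive set $X\subseteq 2^\omega$. In particular, the Dual Borel Conjecture implies that $\mathfrak{d}>\aleph_1$.
   Context: For $f,g\in\omega^\omega$, $f\leq^\star g$ means that $f(n)\leq g(n)$ for all but finitely many $n$. The cardinals are $$\mathfrak{b}=\min\{|F|: F\subseteq\omega^\omega \text{ and } \forall h\in\omega^\omega\ \exists f\in F\ f\not\leq^\star h\},$$ $$\mathfrak{d}=\min\{|F|: F\subseteq\omega^\omega \text{ and } \forall h\in\omega^\omega\ \exists f\in F\ h\leq^\star f\}.$$ $\mathcal{N}$ is the ideal of measure zero subsets of $2^\omega$ with respect to the standard product measure $\mu$, and $\mathcal{M}$ is the ideal of meager subsets of $2^\omega$. $+$ denotes (coordinatewise) addition mod $2$ on $2^\omega$, and for $A,B\subseteq 2^\omega$, $A+B=\{a+b: a\in A,\ b\in B\}$. Let $X\subseteq 2^\omega$. $X$ is meager additive if $X+F\in\mathcal{M}$ for all $F\in\mathcal{M}$. $X$ is null additive if $X+F\in\mathcal{N}$ for all $F\in\mathcal{N}$. $X$ is strongly meager if $X+F\neq 2^\omega$ for all $F\in\mathcal{N}$. The Dual Borel Conjecture is the statement that there are no uncountable strongly meager sets. *)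

(* Defs.v *)
From HB Require Import structures.
From mathcomp Require Import all_boot all_order all_algebra finmap.
From mathcomp Require Import all_classical all_reals all_analysis.
From mathcomp Require wochoice.

Set Implicit Arguments.
Unset Strict Implicit.
Unset Printing Implicit Defensive.

Import Order.TTheory GRing.Theory Num.Theory.
Import numFieldNormedType.Exports.

Local Open Scope classical_set_scope.
Local Open Scope card_scope.
Local Open Scope ring_scope.

(* Cardinals are represented by sets, compared with [#<=], [#=] and [#<]. *)
Definition card_lt T U (A : set T) (B : set U) : Prop := (A #<= B) /\ ~ (B #<= A).
Notation "A '#<' B" := (card_lt A B) (at level 79) : card_scope.

(* A member of [P] of least cardinality, so that its cardinality is
   min {|F| : F in P}; the default [set0] is only used if [P] is empty, see
   [min_cardP]. *)
Definition min_card T (P : set (set T)) : set T :=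
  xget set0 [set F | P F /\ forall G, P G -> F #<= G].

Lemma min_cardP (T : pointedType) (P : set (set T)) : P !=set0 ->
  P (min_card P) /\ forall G, P G -> min_card P #<= G.
Proof.
move=> [F0 PF0]; rewrite /min_card.
apply: (xgetPex set0 (P := [set F | P F /\ forall G, P G -> F #<= G])).
pose sep (S : set (set T -> T)) := (forall g F, S g -> P F -> F (g F)) /\
  forall g h F, S g -> S h -> P F -> g F = h F -> g = h.
have [|S [[Sin Sinj] Smax]] := @Zorn_bigcup _ sep.
  move=> C Csep Ctot; split=> [g F [S CS Sg] PF|g h F [S CS Sg] [S' CS' S'h] PF].
    by have [/(_ g F Sg PF)] := Csep S CS.
  have [SS'|S'S] := Ctot _ _ CS CS'.
    by have [_ /(_ g h F)] := Csep S' CS'; apply => //; exact: SS'.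
  by have [_ /(_ g h F)] := Csep S CS; apply => //; exact: S'S.
have [[F [PF FS]]|noF] :=
    pselect (exists F, P F /\ forall y, F y -> exists2 g, S g & g F = y).
  exists F; split=> // G PG; apply/pcard_leP/injfunPex.
  have /choice[k kP] : forall y, exists g, F y -> S g /\ g F = y.
    move=> y; have [/FS[g Sg gFy]|nFy] := pselect (F y); first by exists g.
    by exists (fun=> y).
  exists (fun y => k y G) => [y /kP[Sk _]|y z /[!inE] Fy Fz e].
    exact: Sin Sk PG.
  have [[Sy yF] [Sz zF]] := (kP _ Fy, kP _ Fz).
  by rewrite -yF -zF (Sinj _ _ _ Sy Sz PG e).
have /choice[g gP] : forall F, exists y, P F -> F y /\ forall h, S h -> h F <> y.
  move=> F; have [PF|nPF] := pselect (P F); last by exists point.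
  apply: contrapT => /forallNP Hy; apply: noF; exists F; split=> // y Fy.
  apply: contrapT => nSy; apply: (Hy y) => _; split=> // h Sh hF.
  by apply: nSy; exists h.
exfalso; apply: (Smax (S `|` [set g])).
  split=> [h Sh|sub]; first by left.
  have /sub Sg : (S `|` [set g]) g by right.
  by have [_ /(_ g Sg)] := gP _ PF0.
split=> [h F [Sh|->] PF|h h' F [Sh|->] [Sh'|->] PF //].
- exact: Sin Sh PF.
- by have [] := gP _ PF.
- exact: Sinj Sh Sh' PF.
- by have [_ /(_ h Sh)] := gP _ PF.
- by move=> /esym; have [_ /(_ h' Sh')] := gP _ PF.
Qed.

Definition le_star (f g : nat -> nat) : Prop :=
  cofinite_set [set n | (f n <= g n)%N].

Definition unbounded_family (F : set (nat -> nat)) : Prop :=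
  forall h, exists2 f, F f & ~ le_star f h.

Definition dominating_family (F : set (nat -> nat)) : Prop :=
  forall h, exists2 f, F f & le_star h f.

Definition frakb : set (nat -> nat) := min_card unbounded_family.
Definition frakd : set (nat -> nat) := min_card dominating_family.

Definition wo_reals : rel (nat -> bool) :=
  sval (wochoice.well_ordering_principle (nat -> bool)).

(* The points with countably many predecessors form an uncountable initial
   segment of this well-ordering, all of whose proper initial segments are
   countable: its order type is omega_1 and its cardinality is aleph_1. *)
Definition aleph1 : set (nat -> bool) :=
  [set x | countable [set y | wo_reals y x]].

Lemma aleph1_uncountable : ~ countable aleph1.
Proof.
move=> cA; have wo : wochoice.well_order wo_reals := svalP _.
have [x nx] : exists x, ~ aleph1 x.
  apply: contrapT => /forallNP H.
  have : [set: nat -> bool] #<= [set: nat].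
    by apply: card_le_trans cA; apply: subset_card_le => x _; exact: contrapT (H x).
  move=> /pcard_injP[f finj].
  have /choice[g gP] : forall n, exists y, forall x, f x = n -> y = x.
    move=> n; have [[y yn]|/forallNP nn] := pselect (exists y, f y = n).
      by exists y => z zn; apply: finj; rewrite ?inE// yn.
    by exists (fun=> false) => z /nn.
  pose d n := ~~ g n n.
  have : g (f d) (f d) = ~~ g (f d) (f d) by rewrite {1}(gP _ d erefl).
  by case: (g _ _).
have [|m [[/negP nm mmin] _]] := wo [pred y | y \notin aleph1].
  by exists x; rewrite inE/=; apply/negP => /set_mem.
apply: nm; apply/mem_set.
have : countable (aleph1 `|` [set m]).
  by rewrite -bigcup2E; apply: bigcup_countable => // -[|[|i]] _ //=;
    exact: countable1.
apply: card_le_trans; apply: subset_card_le => y /= ym.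
have [?|ny] := pselect (aleph1 y); [by left|right].
have my : wo_reals m y by apply: mmin; rewrite inE/=; apply/negP => /set_mem.
have rr z : wo_reals z z.
  have [|w [[/eqP wz +] _]] := wo (pred1 z); first by exists z; rewrite inE.
  by rewrite wz; apply; rewrite inE.
have [|w [_ wU]] := wo (pred2 m y); first by exists m; rewrite inE /= eqxx.
have <- : w = y.
  by apply: wU; split=> [|z]; rewrite inE/= ?eqxx ?orbT// => /pred2P[] ->.
by apply: wU; split=> [|z]; rewrite inE/= ?eqxx// => /pred2P[] ->.
Qed.

Definition determined_below n (A : set cantor_space) : Prop :=
  forall x y : cantor_space, (forall i, (i < n)%N -> x i = y i) -> A x -> A y.

Definition cylinder_algebra : set (set cantor_space) :=
  [set A | exists n, determined_below n A].

Lemma determined_belowW m n A : (m <= n)%N ->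
  determined_below m A -> determined_below n A.
Proof.
by move=> mn mA x y xy; apply: mA => i im; apply: xy; exact: leq_trans im mn.
Qed.

Lemma determined_belowC n A : determined_below n A -> determined_below n (~` A).
Proof. by move=> nA x y xy nAx Ay; apply: nAx; apply: nA Ay => i /xy. Qed.

Lemma determined_belowU n A B : determined_below n A -> determined_below n B ->
  determined_below n (A `|` B).
Proof.
by move=> nA nB x y xy [Ax|Bx]; [left; exact: nA Ax|right; exact: nB Bx].
Qed.

Lemma cylinder_algebra0 : cylinder_algebra set0.
Proof. by exists 0%N. Qed.

Lemma cylinder_algebraU : setU_closed cylinder_algebra.
Proof.
move=> A B [m mA] [n nB]; exists (maxn m n).
by apply: determined_belowU;
  [exact: determined_belowW (leq_maxl _ _) mA|
   exact: determined_belowW (leq_maxr _ _) nB].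
Qed.

Lemma cylinder_algebraC : setC_closed cylinder_algebra.
Proof. by move=> A [n nA]; exists n; exact: determined_belowC. Qed.

Definition cantor_cyl : Type := cantor_space.
Definition cyl_display : measure_display. Proof. exact: default_measure_display. Qed.

HB.instance Definition _ := Pointed.on cantor_cyl.
HB.instance Definition _ := @isAlgebraOfSets.Build cyl_display cantor_cyl
  cylinder_algebra cylinder_algebra0 cylinder_algebraU cylinder_algebraC.

Lemma open_determined n A : determined_below n A -> open A.
Proof.
move=> nA; rewrite openE => x Ax.
have : \forall y \near x, forall i : 'I_n, (y : cantor_space) i = x i.
  apply: (@filter_forall _ _ (fun (i : 'I_n) (y : cantor_space) => y i = x i)
    (nbhs x) _) => i.
  have pc := @proj_continuous nat (fun=> bool) i x.
  exact: (pc [set x (i : nat)] (discrete_set1 _)).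
by apply: filterS => y xy; apply: nA Ax => i ilt; rewrite (xy (Ordinal ilt)).
Qed.

Lemma compact_determined n A : determined_below n A -> compact A.
Proof.
move=> nA; apply: (subclosed_compact _ cantor_space_compact) => //.
by rewrite -openC; apply: open_determined; exact: determined_belowC nA.
Qed.

Definition prepend (b : bool) (x : cantor_space) : cantor_space :=
  fun n => if n is m.+1 then x m else b.

Lemma determined_below_prepend b n A :
  determined_below n.+1 A -> determined_below n (prepend b @^-1` A).
Proof. by move=> nA x y xy; apply: nA => -[|i] //=; exact: xy. Qed.

Section product_measure.
Context (R : realType).

(* The probability of [A], when [A] only depends on the first [n] coordinates
   and these are the outcomes of [n] independent fair coin tosses. *)
Fixpoint coin_prob n (A : set cantor_space) : R :=
  if n is m.+1 then
    (coin_prob m (prepend false @^-1` A) + coin_prob m (prepend true @^-1` A)) / 2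
  else (`[< A (fun=> false) >])%:R.

Definition coin_content (A : set cantor_cyl) : \bar R :=
  (coin_prob (xget 0%N [set n | determined_below n A]) A)%:E.

Lemma coin_prob_ge0 n A : 0 <= coin_prob n A.
Proof.
by elim: n A => [|n IH] A /=; rewrite ?ler0n// divr_ge0// addr_ge0.
Qed.

Lemma coin_probS n A : determined_below n A -> coin_prob n.+1 A = coin_prob n A.
Proof.
elim: n A => [|n IH] A nA.
  have E b : `[< (prepend b @^-1` A) (fun=> false) >] = `[< A (fun=> false) >].
    by apply: asbool_equiv_eq; split; exact: nA.
  by rewrite /= !E -mulr2n -[X in X / _]mulr_natr mulfK// pnatr_eq0.
have IHt := IH _ (determined_below_prepend (b := true) nA).
have IHf := IH _ (determined_below_prepend (b := false) nA).
transitivity ((coin_prob n.+1 (prepend false @^-1` A) +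
  coin_prob n.+1 (prepend true @^-1` A)) / 2); first by [].
by rewrite IHf IHt.
Qed.

Lemma coin_contentE n A : determined_below n A ->
  coin_content A = (coin_prob n A)%:E.
Proof.
move=> nA; rewrite /coin_content; case: xgetP => [m _ /= mA|/(_ n)//].
have aux p k : determined_below p A -> coin_prob (p + k) A = coin_prob p A.
  move=> pA; elim: k => [|k IH]; first by rewrite addn0.
  rewrite addnS coin_probS ?IH//.
  exact: determined_belowW (leq_addr _ _) pA.
by rewrite -(aux m n mA) addnC (aux n m nA).
Qed.

Lemma coin_content_ge0 A : (0 <= coin_content A)%E.
Proof. by rewrite lee_fin coin_prob_ge0. Qed.

Lemma coin_content0 : coin_content set0 = 0%E.
Proof.
by rewrite (@coin_contentE 0%N)//= asboolF.
Qed.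

Lemma coin_probU n A B : A `&` B = set0 ->
  coin_prob n (A `|` B) = coin_prob n A + coin_prob n B.
Proof.
elim: n A B => [|n IH] A B AB0.
  have : ~ (A (fun=> false) /\ B (fun=> false)).
    by move=> AB; have : (A `&` B) (fun=> false) by []; rewrite AB0.
  rewrite /= asbool_or.
  by case: asboolP; case: asboolP => ? ? nAB /=; rewrite ?addr0 ?add0r//; case: nAB.
have disj b : prepend b @^-1` A `&` prepend b @^-1` B = set0.
  by rewrite -preimage_setI AB0 preimage_set0.
transitivity ((coin_prob n (prepend false @^-1` A `|` prepend false @^-1` B) +
  coin_prob n (prepend true @^-1` A `|` prepend true @^-1` B)) / 2).
  by [].
by rewrite (IH _ _ (disj false)) (IH _ _ (disj true)) addrACA mulrDl.
Qed.

Lemma coin_content_additive : measure_function.semi_additive coin_content.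
Proof.
apply/(additive2P coin_content0) => A B [m mA] [n nB] AB0.
have {}mA := determined_belowW (leq_maxl m n) mA.
have {}nB := determined_belowW (leq_maxr m n) nB.
by rewrite (coin_contentE (determined_belowU mA nB)) coin_probU// EFinD
  -(coin_contentE mA) -(coin_contentE nB).
Qed.

HB.instance Definition _ := isContent.Build cyl_display cantor_cyl R coin_content
  coin_content_ge0 coin_content_additive.

Lemma coin_content_sigma_subadditive :
  measurable_subset_sigma_subadditive coin_content.
Proof.
move=> A F mF [n nA] AF.
have := compact_determined nA; rewrite compact_cover => cA.
have [i _||D _ AD] := cA nat setT F.
- by have [m mFi] := mF i; exact: open_determined mFi.
- by move=> x /AF[i _ Fix]; exists i.
have [N DN] : exists N, forall i, i \in D -> (i < N)%N.
  exists (\max_(i <- D) i)%N.+1 => i iD.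
  by rewrite ltnS; exact: (@leq_bigmax_seq _ (enum_fset D) xpredT id i iD isT).
apply: (@le_trans _ _ (\sum_(i < N) coin_content (F i))%E).
  apply: (content_subadditive coin_content) => //.
    by exists n.
  by rewrite -bigcup_mkord => x /AD[i /= /DN iN Fix]; exists i.
rewrite -(big_mkord xpredT (fun i => coin_content (F i))).
by apply: nneseries_lim_ge => i _ _; exact: coin_content_ge0.
Qed.

HB.instance Definition _ := Content_SigmaSubAdditive_isMeasure.Build cyl_display R
  cantor_cyl coin_content coin_content_sigma_subadditive.

(* The standard product measure, as a measure on the sigma-algebra generated by
   the cylinders, that is, on the Borel sets. *)
Definition cantor_measure := measure_extension coin_content.

HB.instance Definition _ := Measure.on cantor_measure.

Lemma cantor_measure_cylinder n (s : nat -> bool) :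
  cantor_measure [set x | forall i, (i < n)%N -> x i = s i] = (2 ^- n)%:E.
Proof.
have cyl_det p t : determined_below p
    [set x : cantor_space | forall i, (i < p)%N -> x i = t i].
  by move=> x y xy xs i ip; rewrite -xy// xs.
rewrite /cantor_measure /measure_extension measurable_mu_extE; last first.
  by exists n; exact: cyl_det.
rewrite /= (coin_contentE (cyl_det n s)); congr EFin.
elim: n s => [|n IH] s; first by rewrite /= asboolT// expr0 invr1.
have E b : prepend b @^-1` [set x | forall i, (i < n.+1)%N -> x i = s i] =
    if b == s 0%N then [set x | forall i, (i < n)%N -> x i = s i.+1] else set0.
  apply/seteqP; split=> x /=; case: eqP => [->|bs] //.
  - by move=> H i lin; exact: (H i.+1).
  - by move=> /(_ 0%N isT).
  - by move=> H [|i]//= /H.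
have P0 m : coin_prob m set0 = 0.
  by apply: EFin_inj; rewrite -(@coin_contentE m set0)// coin_content0.
transitivity ((coin_prob n (prepend false @^-1` [set x | forall i,
    (i < n.+1)%N -> x i = s i]) + coin_prob n (prepend true @^-1` [set x |
    forall i, (i < n.+1)%N -> x i = s i])) / 2); first by [].
rewrite !E exprS invfM mulrC; congr (_ * _).
by case: (s 0%N); rewrite /= P0 ?add0r ?addr0 IH.
Qed.

Lemma cantor_measureT : cantor_measure setT = 1%E.
Proof.
have := cantor_measure_cylinder 0 (fun=> false).
rewrite expr0 invr1 => <-; congr cantor_measure.
by apply/seteqP.
Qed.

HB.instance Definition _ :=
  Measure_isProbability.Build _ _ R cantor_measure cantor_measureT.

End product_measure.

(* Contained in a Borel set of measure zero, i.e., of measure zero for the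
   completion of the product measure. *)
Definition null (R : realType) (A : set cantor_space) : Prop :=
  (cantor_measure R).-negligible A.

Definition nowhere_dense (T : topologicalType) (A : set T) : Prop :=
  interior (closure A) = set0.

Definition meager (T : topologicalType) (A : set T) : Prop :=
  exists2 F : nat -> set T,
    forall n, nowhere_dense (F n) & A `<=` \bigcup_n F n.

Definition cantor_add (x y : cantor_space) : cantor_space :=
  fun n => x n (+) y n.

Definition sumset (A B : set cantor_space) : set cantor_space :=
  [set cantor_add a b | a in A & b in B].

Definition meager_additive (X : set cantor_space) : Prop :=
  forall F, meager F -> meager (sumset X F).

Definition null_additive (R : realType) (X : set cantor_space) : Prop :=
  forall F, null R F -> null R (sumset X F).

Definition strongly_meager (R : realType) (X : set cantor_space) : Prop :=
  forall F, null R F -> sumset X F <> setT.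

Definition dual_Borel_conjecture (R : realType) : Prop :=
  ~ exists2 X : set cantor_space, ~ countable X & strongly_meager R X.

(* Main.v *)
(* Identify subsets of nat with points of 2^omega. Given e_x : nat -> nat for
   x < omega_1, there are infinite A_x, decreasing modulo finite sets, such that
   from some point on any a < b in A_y satisfy e_x a <= b, for all x <= y. The
   set X = {A_x} is the witness in both parts; in each, for a given F, all A_y
   with y beyond some x are treated uniformly, and the countably many others one
   by one, as translates of F are small.

   Meager: every u in a meager F differs from a fixed z on [n, f n) for almost
   all n. If the e_x are unbounded, some e_x exceeds f o f infinitely often. At
   such n, A_y has at most one element in [n, f (f n)), hence misses [n, f n) or
   [f n, f (f n)), so A_y + u differs from z on [n, f (f n)); this happens for
   almost all n in a fixed infinite set, which is a meager condition.

   Null: a null F is contained in limsup C_k, with C_k clopen, of arbitrarily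
   small prescribed measure, and determined by the first f k coordinates. If
   e_x dominates f, then A_x has at most one element p_k in [k, f k), and so A_y
   restricted to f k takes at most 2^(k+1) values, for almost all k. Hence A_y + F
   is contained in the limsup of the unions of 2^(k+1) translates of C_k. *)
Require Import Defs.
From mathcomp Require Import finmap all_boot all_order all_algebra.
From mathcomp Require Import all_classical all_reals all_analysis.
From mathcomp Require wochoice.
From mathcomp Require Import zify.

Set Implicit Arguments.
Unset Strict Implicit.
Unset Printing Implicit Defensive.

Import Order.TTheory GRing.Theory Num.Theory.
Import numFieldNormedType.Exports.

Local Open Scope classical_set_scope.
Local Open Scope card_scope.

(** * Sparse pseudo-intersections of sets of integers *)

Definition frequently (A : nat -> bool) : Prop :=
  forall N, exists2 n, (N <= n)%N & A n.

Definition almost_sub (A B : nat -> bool) : Prop :=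
  exists N, forall n, (N <= n)%N -> A n -> B n.

Definition sparse (e : nat -> nat) (A : nat -> bool) : Prop :=
  exists N, forall a b, (N <= a)%N -> (a < b)%N -> A a -> A b -> (e a <= b)%N.

Lemma almost_sub_trans A B C :
  almost_sub A B -> almost_sub B C -> almost_sub A C.
Proof.
move=> [M AB] [N BC]; exists (maxn M N) => n; rewrite geq_max => /andP[Mn Nn].
by move=> /(AB _ Mn)/(BC _ Nn).
Qed.

(* The second conclusion makes [A] different from every [B i]. *)
Lemma pseudo_intersection (B : nat -> nat -> bool) (g : nat -> nat -> nat) :
  (forall k, frequently (fun n => [forall i : 'I_k, B i n])) ->
  exists2 A, frequently A & forall i,
    [/\ almost_sub A (B i), frequently (fun n => B i n && ~~ A n) &
        sparse (g i) A].
Proof.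
move=> Bfreq.
(* Of two new points beyond [b], [c.1] will be left out of [A] and [c.2] put in. *)
have step k b : exists c : nat * nat,
    [/\ (b < c.1 < c.2)%N, [forall i : 'I_k, B i c.1],
        [forall i : 'I_k, B i c.2] &
        forall i, (i < k)%N -> forall a, (a <= b)%N -> (g i a <= c.2)%N].
  have [m bm Bm] := Bfreq k b.+1.
  pose M := (\sum_(i < k) \sum_(a < b.+1) g i a)%N.
  have [p mp Bp] := Bfreq k (maxn m.+1 M).
  exists (m, p); split=> //=; first by lia.
  move=> i ik a ab.
  have : (g i a <= M)%N.
    rewrite /M (bigD1 (Ordinal ik))//= (bigD1 (Ordinal (ab : (a < b.+1)%N)))//=.
    by rewrite -addnA leq_addr.
  by lia.
have /choice[nxt nxtP] : forall kb : nat * nat, exists c : nat * nat,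
    [/\ (kb.2 < c.1 < c.2)%N, [forall i : 'I_kb.1, B i c.1],
        [forall i : 'I_kb.1, B i c.2] & forall i, (i < kb.1)%N ->
          forall a, (a <= kb.2)%N -> (g i a <= c.2)%N].
  by move=> [k b]; exact: step.
(* [A] will consist of the values [u k.+1]; those beyond [u i.+1] come from stages [k > i], which
   respect [B i] and [g i]. *)
pose u := fix u k := if k is j.+1 then (nxt (j, u j)).2 else 0%N.
have uS k : u k.+1 = (nxt (k, u k)).2 by [].
have u_lt k : (u k < u k.+1)%N.
  by rewrite uS; have [/= h _ _ _] := nxtP (k, u k); lia.
have u_mono : {homo u : i j / (i < j)%N}.
  by apply: homo_ltn => //; exact: ltn_trans.
have u_ge k : (k <= u k)%N.
  by elim: k => // k IH; have := u_lt k; lia.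
have u_le i j : (u i < u j)%N -> (i < j)%N.
  move=> ij; rewrite ltnNge; apply/negP; rewrite leq_eqVlt => /orP[/eqP ji|/u_mono].
    by rewrite ji ltnn in ij.
  by lia.
have AP m : reflect (exists k, u k.+1 = m) `[< exists k, u k.+1 = m >].
  exact: asboolP.
exists (fun m => `[< exists k, u k.+1 = m >]).
  move=> N; exists (u N.+1); last by apply/AP; exists N.
  by have := u_ge N.+1; lia.
move=> i; split.
- exists (u i.+1).+1 => n + /AP[k kn]; rewrite -kn => /u_le ik.
  have [/= _ _ /forallP/= Bk _] := nxtP (k, u k).
  exact: (Bk (Ordinal (ik : (i < k)%N))).
- move=> N; have [k ik Nk] : exists2 k, (i < k)%N & (N <= k)%N.
    by exists (maxn i N).+1; lia.
  have [/= lt /forallP/= Bk _ _] := nxtP (k, u k).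
  exists (nxt (k, u k)).1; first by have := u_ge k; lia.
  rewrite (Bk (Ordinal ik))/=; apply/AP => -[j jn].
  have : (k < j.+1)%N by apply: u_le; rewrite jn; case/andP: lt.
  have : (j.+1 < k.+1)%N by apply: u_le; rewrite jn uS; case/andP: lt.
  by lia.
- exists (u i.+1).+1 => a b + ab /AP[j ja] /AP[k kb].
  move: ab; rewrite -ja -kb => /u_le jk /u_le ij.
  have u_jk : (u j.+1 <= u k)%N.
    have : (j.+1 <= k)%N by lia.
    by rewrite leq_eqVlt => /orP[/eqP->//|/u_mono/ltnW].
  have [_ _ _ /(_ i)] := nxtP (k, u k).
  by apply=> //; rewrite /=; lia.
Qed.

(** * The tower of length omega_1 *)

Section well_order_aleph1.
Let wo : wochoice.well_order wo_reals := svalP _.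
Local Notation le := wo_reals.

(** A well-order of [wochoice] is given by unique minima of nonempty predicates; the order axioms
    below come from minima of at most three points. *)
Lemma wo_reals_min (P : (nat -> bool) -> Prop) x : P x ->
  exists2 m, P m & forall y, P y -> le m y.
Proof.
move=> Px; have [|m [[/asboolP Pm mmin] _]] := @wo [pred y | `[< P y >]].
  by exists x; apply/asboolP.
by exists m => // y Py; apply: mmin; apply/asboolP.
Qed.

Lemma wo_reals_refl x : le x x.
Proof. by have [m <- /(_ x erefl)] := @wo_reals_min (eq x) x erefl. Qed.

Lemma wo_reals_total x y : le x y \/ le y x.
Proof.
have [|m [->|->] mmin] := @wo_reals_min (fun z => z = x \/ z = y) x; first by left.
- by left; apply: mmin; right.
- by right; apply: mmin; left.
Qed.

Lemma wo_reals_anti x y : le x y -> le y x -> x = y.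
Proof.
move=> xy yx; have [|w [_ wU]] := @wo (pred2 x y).
  by exists x; rewrite inE /= eqxx.
have <- : w = y.
  by apply: wU; split=> [|z]; rewrite inE/= ?eqxx ?orbT// => /pred2P[] ->//;
    exact: wo_reals_refl.
by apply/esym/wU; split=> [|z]; rewrite inE/= ?eqxx// => /pred2P[] ->//;
  exact: wo_reals_refl.
Qed.

Lemma wo_reals_trans x y z : le x y -> le y z -> le x z.
Proof.
move=> xy yz.
have [|m mP mmin] := @wo_reals_min (fun t => [\/ t = x, t = y | t = z]) x.
  by constructor.
have [mx my mz] : [/\ le m x, le m y & le m z].
  by split; apply: mmin; [constructor 1|constructor 2|constructor 3].
case: mP => mE; subst m => //.
  by rewrite (wo_reals_anti xy mx).
by rewrite -(wo_reals_anti yz my).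
Qed.

Lemma aleph1_le x y : aleph1 y -> le x y -> aleph1 x.
Proof.
move=> cy xy; apply: sub_countable cy; apply: subset_card_le => z zx.
exact: wo_reals_trans xy.
Qed.

Let lt x y := le x y /\ x <> y.

Lemma wo_reals_wf : well_founded lt.
Proof.
move=> x; apply: contrapT => nx.
have [m nm mmin] := wo_reals_min (P := fun y => ~ Acc lt y) nx; apply: nm.
constructor=> y [ym yNm]; apply: contrapT => /mmin my.
exact/yNm/wo_reals_anti.
Qed.

Let tower_step (e : (nat -> bool) -> nat -> nat) x
    (h : (nat -> bool) -> nat -> bool) : nat -> bool :=
  xget xpredT [set A | frequently A /\ forall y, le y x ->
    [/\ almost_sub A (h y), frequently (fun n => h y n && ~~ A n) &
        sparse (e y) A]].

(** Transfinite recursion: a point of [aleph1] has countably many predecessors, and their sets form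
    a chain under almost inclusion, so [pseudo_intersection] applies. *)
Lemma tower (e : (nat -> bool) -> nat -> nat) :
  exists A : (nat -> bool) -> nat -> bool,
  (forall x y, aleph1 y -> le x y -> sparse (e x) (A y)) /\
  (forall x y, aleph1 y -> le x y -> almost_sub (A y) (A x)) /\
  {in aleph1 &, injective A}.
Proof.
(* Away from the strict predecessors of [x] the value is the whole of nat. *)
pose below x (h : forall y, lt y x -> nat -> bool) y : nat -> bool :=
  if pselect (lt y x) is left p then h y p else xpredT.
pose A := Fix wo_reals_wf (fun=> nat -> bool)
  (fun x h => tower_step e x (below x h)).
pose h x := below x (fun y _ => A y).
have AE x : A x = tower_step e x (h x).
  rewrite {1}/A Fix_eq// => z f g fg; congr tower_step.
  by apply/funext => y; rewrite /below; case: pselect.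
have good x : aleph1 x -> frequently (A x) /\ forall y, le y x ->
    [/\ almost_sub (A x) (h x y), frequently (fun n => h x y n && ~~ A x n) &
        sparse (e y) (A x)].
  elim/(well_founded_ind wo_reals_wf): x => x IH ax; rewrite AE.
  apply: (xgetPex xpredT (P := [set A | frequently A /\ forall y, le y x ->
    [/\ almost_sub A (h x y), frequently (fun n => h x y n && ~~ A n) &
        sparse (e y) A]])).
  have hfreq y : frequently (h x y).
    rewrite /h /below; case: pselect => [yx|_]; last by move=> N; exists N.
    by have [] := IH y yx (aleph1_le ax yx.1).
  have hchain y z : le y z -> almost_sub (h x z) (h x y) \/ almost_sub (h x y) (h x z).
    rewrite /h /below => yz.
    case: (pselect (lt y x)) => [yx|_]; last by left; exists 0%N.
    case: (pselect (lt z x)) => [zx|_]; last by right; exists 0%N.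
    have [<-|yNz] := pselect (y = z); first by left; exists 0%N.
    left; have [_ /(_ y yz)[+ _ _]] := IH z zx (aleph1_le ax zx.1).
    by rewrite /h /below; case: pselect => // -[].
  (* [x] itself is enumerated too: then [e x] is among the functions, and the
     set [h x x] is the whole of nat. *)
  have [c cP] : exists c : nat -> nat -> bool, set_surj setT [set y | le y x] c.
    by apply/pcard_surjP.
  have hdir k : exists y, forall i : 'I_k, almost_sub (h x y) (h x (c i)).
    elim: k => [|k [y yP]]; first by exists xpredT => -[].
    have [ky|ky] : almost_sub (h x (c k)) (h x y) \/ almost_sub (h x y) (h x (c k)).
    - have [/hchain[]|/hchain[]] := wo_reals_total y (c k); tauto.
    - exists (c k) => -[i /= +]; rewrite ltnS leq_eqVlt => /orP[/eqP->|ik].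
        by exists 0%N.
      exact: (almost_sub_trans ky (yP (Ordinal ik))).
    - exists y => -[i /= +]; rewrite ltnS leq_eqVlt => /orP[/eqP->//|ik].
      exact: (yP (Ordinal ik)).
  have [k N|B Bfreq BP] := @pseudo_intersection (fun n => h x (c n)) (fun n => e (c n)).
    have [y /choice[M MP]] := hdir k.
    have [n nN hn] := hfreq y (maxn N (\max_(i < k) M i))%N.
    exists n; first by lia.
    apply/forallP => i; apply: MP hn.
    exact: leq_trans (leq_trans (leq_bigmax i) (leq_maxr _ _)) nN.
  by exists B; split=> // y /cP[n _ <-]; exact: BP.
have hE x y : le x y -> x <> y -> h y x = A x.
  by move=> xy xNy; rewrite /h /below; case: pselect => // -[].
exists A; split; [|split].
- by move=> x y /good[_ H] /H[].
- move=> x y ay xy; have [<-|xNy] := pselect (x = y); first by exists 0%N.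
  by have [_ /(_ x xy)[+ _ _]] := good y ay; rewrite hE.
- have neq x y : aleph1 y -> le x y -> A x = A y -> x = y.
    move=> ay xy Axy; apply: contrapT => xNy.
    have [_ /(_ x xy)[_ + _]] := good y ay.
    by rewrite hE// Axy => /(_ 0%N)[n _]; rewrite andbN.
  move=> x y /set_mem ax /set_mem ay Axy.
  have [xy|yx] := wo_reals_total x y; first exact: neq.
  exact/esym/neq.
Qed.

End well_order_aleph1.

(** * Meager sets and blocks of coordinates *)

Lemma cantor_open_cylinder (U : set cantor_space) (x : cantor_space) :
  open U -> U x ->
  exists n, forall y : cantor_space, (forall i, (i < n)%N -> y i = x i) -> U y.
Proof.
move=> oU Ux.
have : compact (~` U).
  apply: (subclosed_compact _ cantor_space_compact) => //.
  by rewrite closedC.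
rewrite compact_cover => cU.
(* Finitely many coordinates suffice to tell [x] from all points of the compact complement of
   [U]. *)
have [i _||D _ UD] := cU nat setT (fun i => [set y : cantor_space | y i != x i]).
- apply: (@open_determined i.+1) => y z yz; rewrite /= => yi.
  by rewrite -yz.
- move=> y nUy; apply: contrapT => /= ny; apply: nUy; suff -> : y = x by [].
  apply/funext => i; apply/eqP; apply: contrapT => /negP yi.
  by apply: ny; exists i.
exists (\max_(i <- D) i).+1 => y yx; apply: contrapT => /UD[i /= iD /eqP]; apply.
by apply: yx; rewrite ltnS; exact: (@leq_bigmax_seq _ (enum_fset D) xpredT id i iD isT).
Qed.

Lemma nowhere_dense_extend (G : set cantor_space) m (s : nat -> bool) :
  nowhere_dense G -> exists n (w : nat -> bool),
  [/\ (m <= n)%N, forall i, (i < m)%N -> w i = s i &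
      forall v : cantor_space, (forall i, (i < n)%N -> v i = w i) -> ~ G v].
Proof.
move=> nG; pose C := [set v : cantor_space | forall i, (i < m)%N -> v i = s i].
have oC : open C.
  by apply: (@open_determined m) => x y xy Cx i im; rewrite -xy// Cx.
have [w Cw nGw] : exists2 w, C w & ~ closure G w.
  apply: contrapT => nw; have : interior (closure G) s.
    rewrite /interior/= nbhsE; exists C => // w Cw.
    by apply: contrapT => nGw; apply: nw; exists w.
  by rewrite nG.
have [n nP] := @cantor_open_cylinder (~` closure G) w (closed_openC (@closed_closure _ _)) nGw.
exists (maxn m n), w; split=> //; first exact: leq_maxl.
move=> v vw Gv; apply: (nP v) => [i ilt|].
  by apply: vw; rewrite leq_max ilt orbT.
exact: subset_closure.
Qed.

(** A single [w] serves all prefixes of length [m]: these are finitely many, and each in turn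
    lengthens the block without changing the values already fixed. *)
Lemma nowhere_dense_block (G : set cantor_space) m :
  nowhere_dense G -> exists n (w : nat -> bool),
  (m < n)%N /\ forall v : cantor_space,
    (forall i, (m <= i < n)%N -> v i = w i) -> ~ G v.
Proof.
move=> nG.
pose t (g : {ffun 'I_m -> bool}) (i : nat) := if insub i is Some j then g j else false.
have H (L : seq {ffun 'I_m -> bool}) : exists n (w : nat -> bool),
    (m < n)%N /\ forall g, g \in L -> forall v : cantor_space,
      (forall i, (i < m)%N -> v i = t g i) ->
      (forall i, (m <= i < n)%N -> v i = w i) -> ~ G v.
  elim: L => [|g L [n [w [mn IH]]]]; first by exists m.+1, (fun=> false).
  have [n' [w' [nn' w'E w'G]]] :=
    @nowhere_dense_extend G n (fun i => if (i < m)%N then t g i else w i) nG.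
  exists n', w'; split=> [|g']; first by lia.
  rewrite inE => /orP[/eqP -> v vg vw'|g'L v vg' vw'].
    apply: w'G => i ilt; have [im|mi] := ltnP i m; last by rewrite vw'// mi.
    rewrite vg// w'E ?im//; lia.
  apply: (IH g') => // i /andP[mi ilt].
  rewrite vw' ?w'E//; last by lia.
  by rewrite ltnNge mi.
have [n [w [mn wP]]] := H (enum {: {ffun 'I_m -> bool}}).
exists n, w; split=> // v vw; apply: (wP [ffun i : 'I_m => v i]) => //.
  by rewrite mem_enum.
by move=> i im; rewrite /t insubT ffunE.
Qed.

Lemma nowhere_dense_block_seq (G : nat -> set cantor_space) k m :
  (forall j, nowhere_dense (G j)) -> exists n (w : nat -> bool),
  (m < n)%N /\ forall v : cantor_space,
    (forall i, (m <= i < n)%N -> v i = w i) -> forall j, (j < k)%N -> ~ G j v.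
Proof.
move=> nG; elim: k => [|k [n [w [mn wP]]]]; first by exists m.+1, (fun=> false).
have [n' [w' [nn' w'P]]] := @nowhere_dense_block (G k) n (nG k).
exists n', (fun i => if (i < n)%N then w i else w' i); split; first by lia.
move=> v vw j; rewrite ltnS leq_eqVlt => /orP[/eqP ->|jk].
  apply: w'P => i /andP[ni ilt]; rewrite vw ?(leqNgt n i) -?leqNgt ?ni//.
    by rewrite ltnNge ni.
  by lia.
apply: wP jk => i /andP[mi ilt]; rewrite vw ?ilt//; lia.
Qed.

(** On consecutive blocks [[a k, a k.+1)], [z] follows a pattern that forces a point out of [G j]
    for all [j < k]. So a point of [G j] differs from [z] on every block with [k > j]. *)
Lemma meager_avoids_blocks (F : set cantor_space) : meager F ->
  exists (f : nat -> nat) (z : nat -> bool), forall u, F u ->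
  exists N, forall n, (N <= n)%N -> exists2 i, (n <= i < f n)%N & u i <> z i.
Proof.
move=> [G nG FG].
have /choice[nxt nxtP] : forall km : nat * nat, exists nw : nat * (nat -> bool),
    (km.2 < nw.1)%N /\ forall v : cantor_space,
    (forall i, (km.2 <= i < nw.1)%N -> v i = nw.2 i) ->
    forall j, (j < km.1)%N -> ~ G j v.
  by move=> [k m]; have [n [w nwP]] := @nowhere_dense_block_seq G k m nG; exists (n, w).
pose a := fix a k := if k is j.+1 then (nxt (j, a j)).1 else 0%N.
have aS k : a k.+1 = (nxt (k, a k)).1 by [].
have a_lt k : (a k < a k.+1)%N by have [] := nxtP (k, a k).
have a_mono : {homo a : i j / (i <= j)%N}.
  by apply: homo_leq => //; [exact: leq_trans|move=> k; exact/ltnW].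
have a_ge k : (k <= a k)%N by elim: k => // k IH; have := a_lt k; lia.
have /choice[z zP] : forall i, exists b : bool, forall k, (a k <= i < a k.+1)%N ->
    b = (nxt (k, a k)).2 i.
  move=> i; have [[k ki]|nk] := pselect (exists k, (a k <= i < a k.+1)%N).
    exists ((nxt (k, a k)).2 i) => l li; suff -> : k = l by [].
    have [kl|lk|//] := ltngtP k l.
      by have := a_mono k.+1 l kl; lia.
    by have := a_mono l.+1 k lk; lia.
  by exists false => k ki; exfalso; apply: nk; exists k.
(* As [n <= a n], the interval [[n, a n.+1)] contains block [n]. *)
exists (fun n => a n.+1), z => u /FG[j _ Gu]; exists j.+1 => n jn.
have [_ /(_ u) H] := nxtP (n, a n).
apply: contrapT => nu; apply: (H _ j jn) => // i ilt /=.
rewrite -(zP i n)//; apply: contrapT => ui; apply: nu; exists i => //.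
by have [ai ia] := andP ilt; rewrite (leq_trans (a_ge n) ai).
Qed.

Lemma meager_bigcup (T : topologicalType) (F : nat -> set T) :
  (forall n, meager (F n)) -> meager (\bigcup_n F n).
Proof.
move=> mF; have /choice[G GP] : forall n, exists G : nat -> set T,
    (forall k, nowhere_dense (G k)) /\ F n `<=` \bigcup_k G k.
  by move=> n; have [G ? ?] := mF n; exists G.
exists (fun m => if unpickle m is Some nk then G nk.1 nk.2 else set0).
  move=> m; case: unpickle => [[n k]|]; first by have [] := GP n.
  by rewrite /nowhere_dense closure0 interior0.
move=> x [n _ /(GP n).2[k _ Gx]]; exists (pickle (n, k)) => //.
by rewrite pickleK.
Qed.

Lemma meagerS (T : topologicalType) (A B : set T) :
  A `<=` B -> meager B -> meager A.
Proof. by move=> AB [G nG BG]; exists G => // x /AB /BG. Qed.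

(** Each [G N] is closed, and every cylinder has a point outside it: continue with [z] through a
    block that starts in [D] far enough out. *)
Lemma meager_avoiding_blocks (D : set nat) (h : nat -> nat) (z : nat -> bool) :
  (forall N, exists2 n, (N <= n)%N & D n) ->
  meager [set v : cantor_space | exists N, forall n, (N <= n)%N -> D n ->
    exists2 i, (n <= i < h n)%N & v i <> z i].
Proof.
move=> Dinf; pose G N := [set v : cantor_space | forall n, (N <= n)%N -> D n ->
    exists2 i, (n <= i < h n)%N & v i <> z i].
exists G; last by move=> v [N vN]; exists N.
move=> N; have cG : closed (G N).
  rewrite -openC openE => v nGv.
  have [n [Nn Dn vz]] : exists n, [/\ (N <= n)%N, D n &
      forall i, (n <= i < h n)%N -> v i = z i].
    apply: contrapT => nn; apply: nGv => n Nn Dn; apply: contrapT => ni.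
    apply: nn; exists n; split=> // i ilt; apply: contrapT => vi.
    by apply: ni; exists i.
  pose C := [set u : cantor_space | forall i, (i < h n)%N -> u i = v i].
  have oC : open C.
    by apply: (@open_determined (h n)) => x y xy Cx i im; rewrite -xy// Cx.
  rewrite /interior/= nbhsE; exists C => // u uv /(_ n Nn Dn)[i /andP[ni ih]].
  by apply; rewrite uv// vz// ni.
rewrite /nowhere_dense -(closure_id _).1//; apply/seteqP; split=> // s.
rewrite /interior/= nbhsE => -[U [oU Us] UG].
have [m mU] := cantor_open_cylinder oU Us.
have [n nmN Dn] := Dinf (maxn m N).
have /UG : U (fun i => if (i < m)%N then s i else z i).
  by apply: mU => i ->.
move=> /(_ n)[|//|i /andP[ni _]]; first by lia.
by rewrite ifF//; lia.
Qed.

(** * Families of functions and sumsets indexed by [aleph1] *)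

Lemma not_le_starP f g : ~ le_star f g -> forall N, exists2 n, (N <= n)%N & (g n < f n)%N.
Proof.
move=> nfg N; apply: contrapT => nN; apply: nfg.
apply: (sub_finite_set _ (finite_II N)) => n /= /negP; rewrite -ltnNge => gf.
by rewrite ltnNge; apply/negP => Nn; apply: nN; exists n.
Qed.

Lemma le_starP f g : le_star f g -> exists N, forall n, (N <= n)%N -> (f n <= g n)%N.
Proof.
move=> /finite_fsetP[D DE]; exists (\max_(i <- D) i).+1 => n Dn.
apply: contrapT => nfg; have : [set` D] n by rewrite -DE.
move=> /= nD; have := @leq_bigmax_seq _ (enum_fset D) xpredT id n nD isT.
by rewrite leqNgt Dn.
Qed.

(** Running maxima give monotone majorants; monotonicity carries a bound at [n] over to elements of
    a sparse set above [n]. *)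
Lemma aleph1_majorants (F : set (nat -> nat)) : F #<= aleph1 ->
  exists e : (nat -> bool) -> nat -> nat,
  (forall x, {homo e x : m n / (m <= n)%N}) /\
  forall f, F f -> exists2 x, aleph1 x & forall n, (f n <= e x n)%N.
Proof.
move=> /pcard_surjP[g gP]; exists (fun x n => \max_(i < n.+1) g x i); split.
  move=> x m n mn; apply/bigmax_leqP => i _.
  exact: (leq_bigmax (widen_ord (mn : (m.+1 <= n.+1)%N) i)).
move=> f /gP[x ax <-]; exists x => // n.
exact: (leq_bigmax (@ord_max n)).
Qed.

Lemma uncountable_image_aleph1 T (A : (nat -> bool) -> T) :
  {in aleph1 &, injective A} -> ~ countable (A @` aleph1).
Proof. by move=> /inj_card_eq/eq_countable -> /aleph1_uncountable. Qed.


(** [J] is a sigma-ideal, later meager or null. The countably many points up to [x] contribute one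
    translate each. *)
Lemma sumset_image_aleph1 (J : set cantor_space -> Prop)
    (A : (nat -> bool) -> cantor_space) (F : set cantor_space) x :
  (forall B C, B `<=` C -> J C -> J B) ->
  (forall B : nat -> set cantor_space, (forall n, J (B n)) -> J (\bigcup_n B n)) ->
  aleph1 x ->
  (forall y, J [set cantor_add (A y) u | u in F]) ->
  J [set cantor_add (A y) u | y in [set y | aleph1 y /\ wo_reals x y] & u in F] ->
  J (sumset (A @` aleph1) F).
Proof.
move=> JS JU ax Jy Jx.
have [c cP] : exists c : nat -> nat -> bool,
    set_surj setT [set y | wo_reals y x] c by apply/pcard_surjP.
apply: (JS _ (\bigcup_n if n is m.+1 then [set cantor_add (A (c m)) u | u in F]
  else [set cantor_add (A y) u | y in [set y | aleph1 y /\ wo_reals x y] & u in F])).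
  move=> _ [_ [y ay <-] [u Fu <-]]; have [xy|yx] := wo_reals_total x y.
    by exists 0%N => //; exists y => //; exists u.
  by have [m _ <-] := cP y yx; exists m.+1 => //; exists u.
by apply: JU => -[|m].
Qed.

(** * An uncountable meager additive set *)

Theorem uncountable_meager_additive : frakb #<= aleph1 ->
  exists X : set cantor_space, ~ countable X /\ meager_additive X.
Proof.
move=> /aleph1_majorants[e [e_mono e_maj]].
have [A [A_sparse [_ A_inj]]] := tower e.
exists (A @` aleph1); split; first exact: uncountable_image_aleph1.
move=> F /meager_avoids_blocks[f [z Fz]].
have [x ax xh] : exists2 x, aleph1 x & ~ le_star (e x) (f \o f).
  have [|fb _] := @min_cardP _ unbounded_family.
    exists setT => h; exists (fun n => (h n).+1) => // /le_starP[N /(_ N (leqnn N))].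
    by rewrite ltnn.
  have [g /e_maj[x ax gx] gf] := fb (f \o f).
  exists x => // /le_starP[N xf]; apply: gf.
  apply: (sub_finite_set _ (finite_II N)) => n /= /negP; rewrite -ltnNge => fg.
  by rewrite ltnNge; apply/negP => /xf /=; have := gx n; lia.
have {}xh := not_le_starP xh.
apply: (sumset_image_aleph1 (x := x)) => //.
- exact: meagerS.
- exact: meager_bigcup.
- move=> y; apply: (meagerS _ (@meager_avoiding_blocks setT f
    (cantor_add (A y) z) _)); last by move=> N; exists N.
  move=> _ [u /Fz[N uz] <-]; exists N => n Nn _.
  by have [i ni uzi] := uz n Nn; exists i => //; rewrite /cantor_add => /addbI.
- apply: (meagerS _ (@meager_avoiding_blocks [set n | (f (f n) < e x n)%N] (f \o f) z xh)).
  move=> _ [y [ay xy] [u /Fz[N uz] <-]].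
  have [M yM] := A_sparse x y ay xy.
  exists (maxn M N) => n; rewrite geq_max => /andP[Mn Nn] /= fe.
  have [i /andP[ni ifn] uzi] := uz n Nn.
  have [j /andP[nj jfn] uzj] := uz (f n) (leq_trans Nn (leq_trans ni (ltnW ifn))).
  (* If [i] is not in [A y], the sum is [u i] there. Otherwise any later element of [A y] is at
     least [e x i >= e x n > f (f n)], so [j] is not in [A y]. *)
  case yi: (A y i); last first.
    by exists i; [lia|rewrite /cantor_add yi].
  exists j; first by lia.
  suff -> : cantor_add (A y) u j = u j by [].
  rewrite /cantor_add; case yj: (A y j) => //.
  have := yM i j (leq_trans Mn ni) (leq_trans ifn nj) yi yj.
  by have := e_mono x _ _ ni; lia.
Qed.

(** * Null sets as limsups of clopen sets *)

Section null_sets.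
Variable R : realType.
Local Open Scope ring_scope.
Local Notation content := (@coin_content R).

Lemma cylinder_algebra_exists (I : Type) (r : seq I) (A : I -> set cantor_space) :
  (forall i, cylinder_algebra (A i)) ->
  cylinder_algebra (\big[setU/set0]_(i <- r) A i).
Proof.
move=> cA; elim: r => [|i r IH]; first by rewrite big_nil; exact: cylinder_algebra0.
by rewrite big_cons; exact: cylinder_algebraU.
Qed.

Lemma coin_content_bigsetU (I : Type) (r : seq I) (A : I -> set cantor_space) :
  (forall i, cylinder_algebra (A i)) ->
  (content (\big[setU/set0]_(i <- r) A i) <= \sum_(i <- r) content (A i))%E.
Proof.
move=> cA; elim: r => [|i r IH]; first by rewrite !big_nil coin_content0.
rewrite !big_cons; apply: le_trans (leeD2l _ IH).
apply: (@measureU2 _ cantor_cyl R content (A i)); first exact: cA.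
exact: cylinder_algebra_exists.
Qed.

Lemma cantor_measure_content A : cylinder_algebra A ->
  cantor_measure R A = content A.
Proof.
by move=> cA; rewrite /cantor_measure /measure_extension measurable_mu_extE.
Qed.

(** Addition mod 2 is its own inverse, so this preimage is [s + A]. *)
Definition translate (s : cantor_space) (A : set cantor_space) : set cantor_space :=
  [set v | A (cantor_add s v)].

Lemma determined_below_translate n s A :
  determined_below n A -> determined_below n (translate s A).
Proof. by move=> nA x y xy; apply: nA => i /xy xyi; rewrite /cantor_add xyi. Qed.

(** When [s 0] is true, translation swaps the two halves that are averaged. *)
Lemma coin_prob_translate n s A : determined_below n A ->
  coin_prob R n (translate s A) = coin_prob R n A.
Proof.
elim: n s A => [|n IH] s A nA.
  by congr (_%:R); congr nat_of_bool; apply: asbool_equiv_eq; split; exact: nA.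
have E b : prepend b @^-1` translate s A =
    translate (fun i => s i.+1) (prepend (s 0%N (+) b) @^-1` A).
  apply/seteqP; split=> x /=; rewrite /translate /=; apply: nA => -[|i] //.
have D b := IH (fun i => s i.+1) _ (determined_below_prepend (b := b) nA).
transitivity ((coin_prob R n (prepend false @^-1` translate s A) +
  coin_prob R n (prepend true @^-1` translate s A)) / 2); first by [].
rewrite !E !D; transitivity ((coin_prob R n (prepend false @^-1` A) +
  coin_prob R n (prepend true @^-1` A)) / 2); last by [].
by case: (s 0%N) => //=; rewrite addrC.
Qed.

Lemma coin_content_translate s A : cylinder_algebra A ->
  content (translate s A) = content A.
Proof.
move=> [n nA]; rewrite (coin_contentE R nA).
by rewrite (coin_contentE R (determined_below_translate (s := s) nA)) coin_prob_translate.
Qed.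

Lemma nullS (A B : set cantor_space) : A `<=` B -> null R B -> null R A.
Proof. by move=> AB [N [mN N0 BN]]; exists N; split=> // x /AB /BN. Qed.

Lemma null_bigcup (A : nat -> set cantor_space) :
  (forall n, null R (A n)) -> null R (\bigcup_n A n).
Proof. by move=> nA; apply: (@negligible_bigcup _ _ _ (cantor_measure R)). Qed.

Lemma null_neqT (A : set cantor_space) : null R A -> A <> setT.
Proof.
move=> nA AT; have : (cantor_measure R setT = 0)%E.
  by apply/negligibleP => //; rewrite -AT.
by rewrite cantor_measureT => /eqP; rewrite onee_eq0.
Qed.

Lemma null_cover (F : set cantor_space) (eps : R) : null R F -> 0 < eps ->
  exists c : nat -> set cantor_space, [/\ forall m, cylinder_algebra (c m),
    F `<=` \bigcup_m c m & (\sum_(m <oo) content (c m) < eps%:E)%E].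
Proof.
move=> [B [mB B0 FB]] eps0.
pose S := [set (\sum_(k <oo) content (A k))%E | A in
  measurable_cover (T := cantor_cyl) B].
(* The measure is by construction the infimum of the total contents of countable covers from the
   algebra. *)
have S0 : ereal_inf S = 0%E by exact: B0.
have [|_ [c [mc Bc] <-] ceps] := @lb_ereal_inf_adherent R S eps eps0.
  by rewrite S0.
rewrite S0 add0e in ceps.
by exists c; split=> //; exact: subset_trans FB Bc.
Qed.

Lemma series_tail_small (u : nat -> \bar R) (eps : R) :
  (forall n, 0 <= u n)%E -> (\sum_(n <oo) u n < +oo)%E -> 0 < eps ->
  exists N, forall n m, (N <= n)%N -> (\sum_(n <= i < m) u i <= eps%:E)%E.
Proof.
move=> u0 uoo eps0.
have := nneseries_tail_cvg uoo (fun k _ => u0 k).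
move=> /(_ [set y | (y < eps%:E)%E]) /=.
have nb : nbhs (0 : \bar R)%E [set y | (y < eps%:E)%E].
  by apply: open_nbhs_nbhs; split; [exact: open_ereal_lt_ereal|rewrite /= lte_fin].
move=> /(_ nb)[N _ NP]; exists N => n m Nn.
apply: le_trans (ltW (NP n Nn)).
by apply: nneseries_lim_ge => i _ _.
Qed.

Lemma null_limsup_cylinders (F : set cantor_space) (d : nat -> R) :
  null R F -> (forall k, 0 < d k) ->
  exists C : nat -> set cantor_space,
  [/\ forall k, cylinder_algebra (C k),
      forall k, (content (C k) <= (d k)%:E)%E &
      forall u, F u -> forall K, exists2 k, (K <= k)%N & C k u].
Proof.
(* [C k] will unite [k.+1] pieces of content at most [eps k] each. *)
move=> nF d0; pose eps k := d k / k.+1%:R.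
have eps0 k : 0 < eps k by rewrite divr_gt0.
have /choice[c cP] := fun n => null_cover nF (eps0 n).
have /choice[g gP] : forall nk : nat * nat, exists N, forall n m, (N <= n)%N ->
    (\sum_(n <= i < m) content (c nk.1 i) <= (eps nk.2)%:E)%E.
  move=> [n k]; apply: series_tail_small => //.
  by have [_ _ /lt_trans] := cP n; apply; rewrite ltry.
(* [C k] collects the pieces [G n k <= i < G n k.+1] of the covers [c n] for
   [n <= k], so that the n-th cover is spread over the [C k] with [n <= k]. *)
pose G n k := if (k <= n)%N then 0%N else maxn k (g (n, k)).
(* The piece [k = n] starts at 0 and is bounded by the whole cover; later ones lie in a tail beyond
   [g (n, k)]. *)
have GP n k : (n <= k)%N ->
    (\sum_(G n k <= i < G n k.+1) content (c n i) <= (eps k)%:E)%E.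
  move=> nk; rewrite {1}/G; case: leqP => [kn|_].
    have -> : k = n by lia.
    have [_ _ /ltW] := cP n; apply: le_trans.
    by apply: nneseries_lim_ge => i _ _; exact: coin_content_ge0.
  by apply: (gP (n, k)); exact: leq_maxr.
exists (fun k => \big[setU/set0]_(n <- iota 0 k.+1)
  \big[setU/set0]_(i <- index_iota (G n k) (G n k.+1)) c n i).
have calg n k : cylinder_algebra
    (\big[setU/set0]_(i <- index_iota (G n k) (G n k.+1)) c n i).
  by apply: cylinder_algebra_exists => i; have [] := cP n.
split.
- by move=> k; apply: cylinder_algebra_exists.
- move=> k; apply: le_trans (coin_content_bigsetU _ _) _ => //.
  apply: (@le_trans _ _ (\sum_(n <- iota 0 k.+1) (eps k)%:E)%E).
    rewrite big_seq [leRHS]big_seq; apply: lee_sum => n; rewrite mem_iota => /andP[_ nk].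
    apply: le_trans (coin_content_bigsetU _ _) _; first by move=> i; have [] := cP n.
    by apply: GP; lia.
  rewrite sumEFin lee_fin big_const_seq count_predT size_iota iter_addr addr0.
  by rewrite -mulr_natr /eps divfK.
- move=> u Fu K; have [_ /(_ u Fu)[m _ cu] _] := cP K.
  have [k] : exists2 k, (K <= k)%N & (G K k <= m < G K k.+1)%N.
    (* [G K] need not be monotone; the least such [j] ends a piece that contains [m]. *)
    have ex : exists j, (m < G K j)%N.
      exists (maxn m K).+1; rewrite /G ifF; first by lia.
      by apply/negbTE; lia.
    have := ex_minnP ex; case=> -[|k]; first by rewrite /G leq0n.
    move=> mk /(_ k) kmin; exists k; last first.
      by rewrite mk andbT leqNgt; apply/negP => /kmin; rewrite ltnn.
    by rewrite leqNgt; apply/negP => kK; move: mk; rewrite /G kK.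
  move=> Kk Gk; exists k => //.
  rewrite -bigcup_seq; exists K.
    by have : K \in iota 0 k.+1 by rewrite mem_iota; lia.
  by rewrite -bigcup_seq; exists m => //=; rewrite mem_index_iota.
Qed.

(** Borel-Cantelli. *)
Lemma null_limsup (D : nat -> set cantor_space) :
  (forall k, cylinder_algebra (D k)) ->
  (forall k, (content (D k) <= (1 / (2 ^ k.+1)%:R)%:E)%E) ->
  null R [set v | forall K, exists2 k, (K <= k)%N & D k v].
Proof.
move=> cD Dle.
have mD k : measurable (D k : set (g_sigma_algebraType (@measurable _ cantor_cyl))).
  by apply: sub_sigma_algebra; exact: cD.
exists (lim_sup_set D); split.
- by apply: bigcap_measurable => // n _; exact: bigcup_measurable.
- apply: (lim_sup_set_cvg0 (mu := cantor_measure R)) => //.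
  apply: (@le_lt_trans _ _ 1%E); last exact: ltry.
  apply: le_trans (epsilon_trick0 xpredT ler01).
  apply: lee_nneseries => // k _.
  by apply: le_trans (Dle k); rewrite -(cantor_measure_content (cD k)).
- by move=> v vD n _; have [k nk Dv] := vD n; exists k.
Qed.

(** [f] is fixed before [t], so the translations may depend on it; only the sizes of the [I k] enter
    the choice of [C k]. *)
Lemma null_translates (F : set cantor_space) (I : nat -> finType) : null R F ->
  exists f : nat -> nat, forall t : forall k, I k -> cantor_space,
  null R [set v | exists2 u, F u & exists K, forall k, (K <= k)%N ->
    exists i, forall j, (j < f k)%N -> v j = t k i j (+) u j].
Proof.
move=> nF; pose d k : R := (1 / (2 ^ k.+1)%:R) / #|I k|.+1%:R.
have [|C [cC Cd FC]] := null_limsup_cylinders (d := d) nF.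
  by move=> k; rewrite !divr_gt0// ltr0n expn_gt0.
have /choice[f fC] := cC.
exists f => t.
pose D k := \big[setU/set0]_(i <- enum (I k)) translate (t k i) (C k).
have cT k i : cylinder_algebra (translate (t k i) (C k)).
  by exists (f k); exact: determined_below_translate.
apply: (@nullS _ [set v | forall K, exists2 k, (K <= k)%N & D k v]).
  move=> v [u Fu [K vK]] L; have [k KLk Cu] := FC u Fu (maxn K L).
  exists k; first by lia.
  (* Below [f k], which is all that [C k] depends on, [t k i + v] agrees with [u]. *)
  have [i vi] := vK k ltac:(lia).
  rewrite /D -bigcup_seq; exists i; first by rewrite /= mem_enum.
  by apply: (fC k) Cu => j jf; rewrite /cantor_add vi// addbA addbb.
apply: null_limsup => k; first exact: cylinder_algebra_exists.
apply: le_trans (coin_content_bigsetU _ _) _ => //.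
apply: (@le_trans _ _ (\sum_(i <- enum (I k)) (d k)%:E)%E).
  by apply: lee_sum => i _; rewrite coin_content_translate.
rewrite sumEFin lee_fin big_const_seq count_predT -cardE iter_addr addr0.
rewrite -[leLHS]mulr_natr /d mulrAC ler_pdivrMr ?ltr0n// ler_wpM2l ?ler_nat//.
Qed.

End null_sets.

(** * An uncountable null additive set *)

Theorem uncountable_null_additive (R : realType) : frakd #<= aleph1 ->
  exists X : set cantor_space, ~ countable X /\ null_additive R X.
Proof.
move=> /aleph1_majorants[e [e_mono e_maj]].
have [A [A_sparse [A_sub A_inj]]] := tower e.
exists (A @` aleph1); split; first exact: uncountable_image_aleph1.
move=> F nF.
have [f fF] := null_translates (fun k => {ffun 'I_k -> bool} * bool)%type nF.
(* With one translate per [k], this yields translation invariance of null sets. *)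
have [f1 f1F] := null_translates (fun k => unit : finType) nF.
have [x ax [N fe]] : exists2 x, aleph1 x &
    exists N, forall n, (N <= n)%N -> (f n <= e x n)%N.
  have [|fd _] := @min_cardP _ dominating_family.
    by exists setT => h; exists h => //; apply: (sub_finite_set _ (finite_II 0)) => n /=;
      rewrite leqnn.
  have [g /e_maj[x ax gx] /le_starP[N fg]] := fd f.
  by exists x => //; exists N => n /fg fgn; exact: leq_trans (gx n).
apply: (sumset_image_aleph1 (x := x)) => //.
- exact: nullS.
- exact: null_bigcup.
- move=> y; apply: nullS (f1F (fun=> fun=> A y)) => _ [u Fu <-].
  by exists u => //; exists 0%N => k _; exists tt.
have [M xM] := A_sparse x x ax (wo_reals_refl x).
(* Elements [c < d] of [A x] in [[k, f k)] would give [f k <= e x k <= e x c <= d]. *)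
have /choice[p pP] : forall k, exists p, (maxn M N <= k)%N ->
    forall a, (k <= a < f k)%N -> A x a -> a = p.
  move=> k; have [[a [ka Aa]]|na] := pselect (exists a, (k <= a < f k)%N /\ A x a).
    exists a => MNk; have H c d : (k <= c < f k)%N -> (k <= d < f k)%N ->
        A x c -> A x d -> (c < d)%N -> False.
      move=> kc kd Ac Ad cd; have := xM c d ltac:(lia) cd Ac Ad.
      have kc' : (k <= c)%N by lia.
      by have := e_mono x _ _ kc'; have := fe k ltac:(lia); lia.
    move=> b kb Ab; have [ab|ba|//] := ltngtP b a.
      by case: (H b a).
    by case: (H a b).
  by exists 0%N => _ a ka Aa; exfalso; apply: na; exists a.
(* The candidates for [A y] below [f k]: free bits before [k], then at most the element [p k]. *)
pose t k (gb : {ffun 'I_k -> bool} * bool) : cantor_space := fun i =>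
  if insub i is Some j then gb.1 j else gb.2 && (i == p k).
apply: nullS (fF t) => _ [y [ay xy] [u Fu <-]].
have [L yL] := A_sub x y ay xy.
exists u => //; exists (maxn L (maxn M N)) => k Lk.
exists ([ffun i : 'I_k => A y i], A y (p k)) => j jf.
rewrite /cantor_add; congr addb; rewrite /t /=; case: insubP => [i _ <-|].
  by rewrite ffunE.
rewrite -leqNgt => kj; have [->|jp] := eqVneq j (p k); first by rewrite andbT.
rewrite andbF; apply/negbTE/negP => Aj; move/eqP: jp; apply.
by apply: pP; [lia|rewrite kj|apply: yL => //; lia].
Qed.

(** * The Dual Borel Conjecture *)

Lemma null_additive_strongly_meager (R : realType) (X : set cantor_space) :
  null_additive R X -> strongly_meager R X.
Proof. by move=> nX F /nX; exact: null_neqT. Qed.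

Lemma card_le_total (T : pointedType) (A B : set T) : A #<= B \/ B #<= A.
Proof.
have [|PM MP] := @min_cardP _ [set C | C = A \/ C = B]; first by exists A; left.
have [MA|MB] := PM.
  by left; rewrite -[X in X #<= _]MA; apply: MP; right.
by right; rewrite -[X in X #<= _]MB; apply: MP; left.
Qed.

(** [card_le_total] compares subsets of one type, so [aleph1] is first copied into [nat -> nat]. *)
Lemma aleph1_frakd_total : aleph1 #<= frakd \/ frakd #<= aleph1.
Proof.
pose emb (x : nat -> bool) n : nat := x n.
have emb_inj : injective emb.
  move=> x y xy; apply/funext => n; have := congr1 (@^~ n) xy.
  by rewrite /emb; case: (x n) (y n) => -[].
have emb_card : emb @` aleph1 #= aleph1 by apply: inj_card_eq => x y _ _ /emb_inj.
by rewrite -(card_le_eql emb_card) -(card_le_eqr emb_card); exact: card_le_total.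
Qed.

Theorem theorem2 (R : realType) :
  (frakb #= aleph1 ->
     exists X : set cantor_space, ~ countable X /\ meager_additive X) /\
  (frakd #= aleph1 ->
     exists X : set cantor_space, ~ countable X /\ null_additive R X) /\
  (dual_Borel_conjecture R -> aleph1 #< frakd).
Proof.
split; first by rewrite card_eq_le => /andP[/uncountable_meager_additive].
split; first by rewrite card_eq_le => /andP[/(uncountable_null_additive R)].
move=> dBC; have nd : ~ (frakd #<= aleph1).
  move=> /(uncountable_null_additive R)[X [ucX /null_additive_strongly_meager smX]].
  by apply: dBC; exists X.
by split=> //; have [] := aleph1_frakd_total.
Qed.
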